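(* Let $r\ge 3$ be an integer and let $L_n=C_n^b$ with $b(x)=(2x+1)^2$. Then the sequence $\{L_n \bmod 3^r\}_{n\ge0}$ is eventually periodic with period dividing $2\cdot 3^{r-3}$; that is, there is $N$ such that $L_{n+2\cdot 3^{r-3}}\equiv L_n\pmod{3^r}$ for all $n\ge N$.
   Context: A Dyck path of semilength $n$ is a sequence of lattice points $(0,0)=(x_0,y_0),\dots,(x_{2n},y_{2n})=(2n,0)$ with all $y_i\ge0$ and each step equal to $(1,1)$ or $(1,-1)$. An up-step starting at height $y$ has weight $b(y)$, a down-step has weight $1$, and a path's weight is the product of its step weights. $C_n^b$ is the sum of the weights of all Dyck paths of semilength $n$. (With $b(x)=(2x+1)^2$, $L_n$ is the number of combinatorial types of Morse links of order $n$.) *)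

(* Defs.v *)
From HB Require Import structures.
From mathcomp Require Import all_boot all_order all_algebra.

Set Implicit Arguments.
Unset Strict Implicit.
Unset Printing Implicit Defensive.

Import Order.TTheory GRing.Theory Num.Theory.

Local Open Scope ring_scope.

Definition lattice_point : Type := (int * int)%type.

Definition up_step (p q : lattice_point) : bool := q - p == (1, 1).
Definition down_step (p q : lattice_point) : bool := q - p == (1, -1).

Definition is_dyck_path (n : nat) (s : seq lattice_point) : bool :=
  [&& size s == n.*2.+1,
      nth 0 s 0 == (0, 0),
      nth 0 s n.*2 == (n.*2%:Z, 0),
      all (fun p : lattice_point => 0 <= p.2) s &
      sorted (fun p q => up_step p q || down_step p q) s].

(* Only up-steps carry [b]; on a Dyck path every other step is a down-step. *)
Definition step_weight (b : int -> int) (p q : lattice_point) : int :=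
  if up_step p q then b p.2 else 1.

Definition path_weight (b : int -> int) (s : seq lattice_point) : int :=
  \prod_(i < (size s).-1) step_weight b (nth 0 s i) (nth 0 s i.+1).

(* The lattice path from the origin whose i-th step is (1, 1) if the i-th
   letter of [w] is [true], and (1, -1) if it is [false]. *)
Definition path_of (w : seq bool) : seq lattice_point :=
  (0, 0) :: scanl (fun (p : lattice_point) (u : bool) =>
                     (p.1 + 1, p.2 + (if u then 1 else -1))) (0, 0) w.

(* Dyck paths are enumerated through their words of steps, so as to sum over a
   finite type; [path_of_inj] and [dyck_path_of] show that each Dyck path of
   semilength n is counted exactly once. *)
Definition dyck_sum (b : int -> int) (n : nat) : int :=
  \sum_(w : n.*2.-tuple bool | is_dyck_path n (path_of w))
     path_weight b (path_of w).

Definition morse_b (x : int) : int := (2 * x + 1) ^+ 2.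

Definition L (n : nat) : int := dyck_sum morse_b n.

Lemma path_of_inj : injective path_of.
Proof.
rewrite /path_of => w w' [].
elim: w w' (0, 0) => [|u w IH] [|u' w'] p //= [e] /[dup] e1.
have -> : u = u' by move: u u' e {e1} => [] [] // /addrI.
by move=> /IH ->.
Qed.

Lemma dyck_path_of (n : nat) (s : seq lattice_point) :
  is_dyck_path n s -> exists w : n.*2.-tuple bool, s = path_of w.
Proof.
case/and5P=> /eqP; case: s => // p s [size_s] /= /eqP -> _ _ steps_s.
suff [w size_w ->] : exists2 w : seq bool, size w = n.*2 &
    s = scanl (fun (p : lattice_point) (u : bool) =>
                 (p.1 + 1, p.2 + (if u then 1 else -1))) (0, 0) w.
  have sz_w : size w == n.*2 by apply/eqP.
  by exists (Tuple sz_w).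
elim: s (n.*2) size_s (0, 0) steps_s {p} => [|q s IH] m /= <- p.
  by exists [::].
case/andP=> step_pq /(IH _ erefl) [w size_w ->].
have step_eq u : q - p == (1, if u then 1 else -1) ->
    q = (p.1 + 1, p.2 + (if u then 1 else -1)).
  by move/eqP/(canRL (subrK p)) ->; rewrite addrC.
case/orP: step_pq => [/(step_eq true)|/(step_eq false)] ->.
- by exists (true :: w); rewrite /= ?size_scanl.
- by exists (false :: w); rewrite /= ?size_scanl.
Qed.

(* Main.v *)
(* Let a_h be the generating series of the weighted walks from height h to 0,
   so that a_0 = 1 + t a_1 and a_h = a_(h-1) + b(h) t a_(h+1).  Put
   iota = 1 / (1 - t^2) and w = 3 iota, which is nilpotent modulo 3^r, so that
   1 - w x is invertible there for every x in Z[t][w].  Since b(h) is divisible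
   by 9 for h = 1 mod 3 and is 1 mod 3 otherwise, each block of three heights
   contributes a denominator 1 + t modulo 3, and solving the recurrence block by
   block gives, modulo 3^r, a_0 = iota p + 3 w^2 x with p in Z[t] and x in
   Z[t][w].  Finally d_k = 1 - t^(2 * 3^k) is a multiple of 1 - t^2, and
   d_(k+1) = d_k (3 - 3 d_k + d_k^2) gives by induction on k that d_k w^i is a
   polynomial modulo 3^(k+2); with r = k + 3, d_k a_0 is then a polynomial
   modulo 3^r, which is the claimed periodicity. *)
Require Import Defs.
From HB Require Import structures.
From mathcomp Require Import all_boot all_order all_algebra.
From mathcomp Require Import boolp.
From mathcomp Require Import ring zify.

Import Order.TTheory GRing.Theory Num.Theory.
Local Open Scope ring_scope.

(** * Formal power series *)

Definition fps (R : Type) : Type := nat -> R.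

HB.instance Definition _ (R : Type) := gen_eqMixin (fps R).
HB.instance Definition _ (R : Type) := gen_choiceMixin (fps R).

Section PowerSeries.
Variable R : comNzRingType.
Implicit Types f g h : fps R.

Definition fps_mul f g : fps R := fun n => \sum_(i < n.+1) f i * g (n - i)%N.

Fact fps_addA : associative (fun f g : fps R => (fun n => f n + g n) : fps R).
Proof. by move=> f g h; apply/funext => n; rewrite addrA. Qed.
Fact fps_addC : commutative (fun f g : fps R => (fun n => f n + g n) : fps R).
Proof. by move=> f g; apply/funext => n; rewrite addrC. Qed.
Fact fps_add0 :
  left_id (fun=> 0 : R) (fun f g : fps R => (fun n => f n + g n) : fps R).
Proof. by move=> f; apply/funext => n; rewrite add0r. Qed.
Fact fps_addN : left_inverse (fun=> 0 : R) (fun f : fps R => fun n => - f n)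
  (fun f g : fps R => (fun n => f n + g n) : fps R).
Proof. by move=> f; apply/funext => n; rewrite addNr. Qed.

HB.instance Definition _ :=
  GRing.isZmodule.Build (fps R) fps_addA fps_addC fps_add0 fps_addN.

Definition fps_trunc n f : {poly R} := \poly_(i < n) f i.

Lemma coef_fps_trunc n f i : (i < n)%N -> (fps_trunc n f)`_i = f i.
Proof. by rewrite coef_poly => ->. Qed.

(** A coefficient of a product involves no coefficients of higher index, so products may be computed
    on truncations; associativity and commutativity are then inherited from polynomials. *)
Lemma fps_mul_coef n f g (p q : {poly R}) :
  (forall i, (i <= n)%N -> p`_i = f i) ->
  (forall i, (i <= n)%N -> q`_i = g i) -> fps_mul f g n = (p * q)`_n.
Proof.
move=> pf qg; rewrite coefM; apply: eq_bigr => i _.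
by rewrite pf ?qg ?leq_subr // -ltnS.
Qed.

Lemma fps_mul_trunc n f g i : (i < n)%N ->
  (fps_trunc n f * fps_trunc n g)`_i = fps_mul f g i.
Proof.
by move=> ltin; rewrite -(@fps_mul_coef i f g) // => j leji;
  rewrite coef_fps_trunc // (leq_ltn_trans leji).
Qed.

Fact fps_mulA : associative fps_mul.
Proof.
move=> f g h; apply/funext => n; pose T := fps_trunc n.+1.
rewrite (@fps_mul_coef _ f _ (T f) (T g * T h)); last 2 first.
- by move=> i lein; rewrite coef_fps_trunc.
- by move=> i lein; rewrite fps_mul_trunc.
rewrite mulrA -(@fps_mul_coef _ (fps_mul f g) h) // => i lein.
- by rewrite fps_mul_trunc.
- by rewrite coef_fps_trunc.
Qed.

Fact fps_mulC : commutative fps_mul.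
Proof.
move=> f g; apply/funext => n.
by rewrite -!(@fps_mul_trunc n.+1) // mulrC.
Qed.

Definition fps_one : fps R := fun n => (n == 0)%:R.

Fact fps_mul1 : left_id fps_one fps_mul.
Proof.
move=> f; apply/funext => n.
rewrite /fps_mul big_ord_recl subn0 mul1r big1 ?addr0 // => i _.
by rewrite mul0r.
Qed.

Fact fps_mulDl : left_distributive fps_mul +%R.
Proof.
move=> f g h; apply/funext => n; rewrite [RHS]/GRing.add /=.
by rewrite -big_split; apply: eq_bigr => i _; rewrite mulrDl.
Qed.

Fact fps_one_neq0 : fps_one != 0.
Proof.
by apply/eqP => /(congr1 (fun f : fps R => f 0)) /eqP; rewrite oner_eq0.
Qed.

HB.instance Definition _ := GRing.Zmodule_isComNzRing.Build (fps R)
  fps_mulA fps_mulC fps_mul1 fps_mulDl fps_one_neq0.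

Lemma fpsDE f g n : (f + g) n = f n + g n. Proof. by []. Qed.
Lemma fpsNE f n : (- f) n = - f n. Proof. by []. Qed.
Lemma fpsME f g n : (f * g) n = \sum_(i < n.+1) f i * g (n - i)%N.
Proof. by []. Qed.
Lemma fps1E n : (1 : fps R) n = (n == 0)%:R. Proof. by []. Qed.

Lemma fps_mulrnE f m n : (f *+ m) n = f n *+ m.
Proof. by elim: m => // m IH; rewrite !mulrS fpsDE IH. Qed.

Lemma fps_natME m f n : (m%:R * f) n = m%:R * f n.
Proof. by rewrite !mulr_natl fps_mulrnE. Qed.

Definition fpsX : fps R := fun n => (n == 1)%:R.

Lemma fpsX_mul0 f : (fpsX * f) 0 = 0.
Proof. by rewrite fpsME big_ord1 mul0r. Qed.

Lemma fpsX_mulS f n : (fpsX * f) n.+1 = f n.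
Proof.
rewrite fpsME !big_ord_recl mul0r add0r mul1r subSS subn0 big1 ?addr0 // => i _.
by rewrite mul0r.
Qed.

Lemma fpsXn_mulE m f n : (fpsX ^+ m * f) n = if (n < m)%N then 0 else f (n - m)%N.
Proof.
elim: m n => [|m IH] n; first by rewrite mul1r subn0.
rewrite exprS -mulrA; case: n => [|n]; first by rewrite fpsX_mul0.
by rewrite fpsX_mulS IH ltnS.
Qed.

End PowerSeries.

(** * Walks counted by their starting height *)

(** Only heights are tracked, since the number of steps fixes the abscissa. The starting height is
    arbitrary so that removing the first step leaves an object of the same kind. *)
Fixpoint good_word (y : int) (w : seq bool) : bool :=
  if w is u :: w' then (0 <= y) && good_word (y + (if u then 1 else -1)) w'
  else y == 0.

Fixpoint word_weight (b : int -> int) (y : int) (w : seq bool) : int :=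
  if w is u :: w' then
    (if u then b y else 1) * word_weight b (y + (if u then 1 else -1)) w'
  else 1.

Definition walk (p : lattice_point) (w : seq bool) : seq lattice_point :=
  scanl (fun (p : lattice_point) (u : bool) =>
           (p.1 + 1, p.2 + (if u then 1 else -1))) p w.

Lemma up_step_walk (p : lattice_point) (u : bool) :
  up_step p (p.1 + 1, p.2 + (if u then 1 else -1)) = u.
Proof.
by rewrite /up_step -pair_eqE /= ![_ + _ - _]addrAC !subrr !add0r; case: u.
Qed.

Lemma down_step_walk (p : lattice_point) (u : bool) :
  down_step p (p.1 + 1, p.2 + (if u then 1 else -1)) = ~~ u.
Proof.
by rewrite /down_step -pair_eqE /= ![_ + _ - _]addrAC !subrr !add0r; case: u.
Qed.

Lemma walk_steps p w :
  path (fun p q => up_step p q || down_step p q) p (walk p w).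
Proof.
by elim: w p => //= u w IH p; rewrite up_step_walk down_step_walk orbN IH.
Qed.

Lemma good_wordE p w :
  good_word p.2 w = all (fun q : lattice_point => 0 <= q.2) (p :: walk p w) &&
    (last p (walk p w) == (p.1 + (size w)%:Z, 0)).
Proof.
elim: w p => [|u w IH] p /=.
  case: p => x y /=; rewrite -pair_eqE /= addr0 eqxx /= andbT.
  by case: eqP => [->|]; rewrite ?andbF.
rewrite (IH (p.1 + 1, _)) /= -!andbA; congr (_ && (_ && (_ && (_ == (_, _))))).
by lia.
Qed.

Lemma is_dyck_path_of n (w : n.*2.-tuple bool) :
  is_dyck_path n (path_of w) = good_word 0 w.
Proof.
rewrite /is_dyck_path (good_wordE (0, 0)) add0r size_tuple.
rewrite -/(walk (0, 0) w) /= size_scanl size_tuple eqxx /= walk_steps andbT.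
have -> : nth 0 ((0, 0) :: walk (0, 0) w) n.*2 = last (0, 0) (walk (0, 0) w).
  by rewrite -[RHS](nth_last 0 (_ :: _)) [size _]/= size_scanl size_tuple.
by rewrite andbC.
Qed.

Lemma path_weight_of b w : path_weight b (path_of w) = word_weight b 0 w.
Proof.
rewrite /path_weight /path_of /= -/(walk (0, 0) w) size_scanl.
rewrite -[0 in RHS]/(snd ((0, 0) : lattice_point)).
elim: w ((0, 0) : lattice_point) => [|u w IH] p /=; first by rewrite big_ord0.
by rewrite big_ord_recl /= /step_weight up_step_walk -(IH (p.1 + 1, _)).
Qed.

Definition word_sum (b : int -> int) (n : nat) (y : int) : int :=
  \sum_(w : n.-tuple bool | good_word y w) word_weight b y w.

Lemma dyck_sumE b n : dyck_sum b n = word_sum b n.*2 0.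
Proof.
apply: eq_big => [w|w _]; first by rewrite is_dyck_path_of.
by rewrite path_weight_of.
Qed.

Lemma word_sum0 b y : word_sum b 0 y = (y == 0)%:R.
Proof.
rewrite /word_sum big_mkcond (big_pred1 [tuple]) /=; last first.
  by move=> w /=; apply/esym/eqP; apply: tuple0.
by case: ifP.
Qed.

Lemma word_sumS b n y : 0 <= y ->
  word_sum b n.+1 y = b y * word_sum b n (y + 1) + word_sum b n (y - 1).
Proof.
move=> y_ge0; rewrite /word_sum.
rewrite (reindex (fun p : bool * n.-tuple bool => cons_tuple p.1 p.2)) /=; last first.
  exists (fun w : n.+1.-tuple bool => (thead w, [tuple of behead w])) => [[u w] _|w _].
    by congr pair; apply/val_inj.
  by rewrite [RHS]tuple_eta; apply/val_inj.
(* The trivial conjunct gives the predicate the shape required by [pair_big_dep]. *)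
rewrite y_ge0 /= (eq_bigl (fun p : bool * n.-tuple bool =>
   true && good_word (y + (if p.1 then 1 else -1)) p.2)) //.
rewrite -(pair_big_dep xpredT (fun u (w : n.-tuple bool) =>
    good_word (y + (if u then 1 else -1)) w) (fun u w =>
    (if u then b y else 1) * word_weight b (y + (if u then 1 else -1)) w)) /=.
rewrite big_bool /= big_distrr /=; congr (_ + _).
by apply: eq_bigr => w _; rewrite mul1r.
Qed.

Lemma word_sum_lt0 b n y : y < 0 -> word_sum b n y = 0.
Proof.
move=> y_lt0; rewrite /word_sum big_pred0 // => w.
case: (tval w) => /= [|u w']; first by apply/eqP; lia.
by rewrite leNgt y_lt0.
Qed.

(** A step lowers the height by at most 1. *)
Lemma word_sum_gt b n y : n%:Z < y -> word_sum b n y = 0.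
Proof.
elim: n y => [|n IH] y lt_ny; first by rewrite word_sum0; case: eqP => //; lia.
by rewrite word_sumS ?IH ?mulr0 //; lia.
Qed.

(** * Series modulo powers of 3 *)

(** This says that [f] is a polynomial modulo [d]. Eventual periodicity of [f] modulo [d] with
    period [m] is this property for [(1 - t ^+ m) * f]. *)
Definition eventually_dvd (d : int) (f : fps int) : Prop :=
  exists N : nat, forall n : nat, (N <= n)%N -> (d %| f n)%Z.

Lemma eventually_dvd_weaken d d' f :
  (d %| d')%Z -> eventually_dvd d' f -> eventually_dvd d f.
Proof.
by move=> dd' [N fN]; exists N => n leNn; apply: dvdz_trans dd' (fN n leNn).
Qed.

Lemma eventually_dvdD d f g :
  eventually_dvd d f -> eventually_dvd d g -> eventually_dvd d (f + g).
Proof.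
move=> [N fN] [M gM]; exists (maxn N M) => n; rewrite geq_max => /andP[leN leM].
by rewrite fpsDE rpredD ?fN ?gM.
Qed.

Lemma eventually_dvdN d f : eventually_dvd d f -> eventually_dvd d (- f).
Proof. by move=> [N fN]; exists N => n leNn; rewrite fpsNE rpredN fN. Qed.

Lemma eventually_dvdM d f g :
  eventually_dvd d f -> eventually_dvd d g -> eventually_dvd d (f * g).
Proof.
move=> [N fN] [M gM]; exists (N + M)%N => n le_n; rewrite fpsME.
apply: rpred_sum => i _; have [leNi|ltiN] := leqP N i.
  by rewrite dvdz_mulr ?fN.
by rewrite dvdz_mull // gM //; lia.
Qed.

Lemma eventually_dvd_natM (m : nat) d f :
  eventually_dvd d f -> eventually_dvd (m%:R * d) (m%:R * f).
Proof.
by move=> [N fN]; exists N => n /fN ?; rewrite fps_natME dvdz_mul.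
Qed.

Lemma eventually_dvd_nat (m : nat) (f : fps int) :
  eventually_dvd m%:R (m%:R * f).
Proof. by exists 0%N => n _; rewrite fps_natME dvdz_mulr. Qed.

Lemma eventually_dvd1 d : eventually_dvd d 1.
Proof. by exists 1%N => -[|n] // _; rewrite fps1E /= dvdz0. Qed.

Lemma eventually_dvdX d : eventually_dvd d (fpsX int).
Proof. by exists 2%N => -[|[|n]] // _; rewrite dvdz0. Qed.

Lemma eventually_dvd0 d : eventually_dvd d 0.
Proof. by exists 0%N => n _; rewrite dvdz0. Qed.

Lemma eventually_dvd_natr d m : eventually_dvd d m%:R.
Proof.
elim: m => [|m IH]; first exact: eventually_dvd0.
by rewrite mulrS; apply: eventually_dvdD (eventually_dvd1 d) IH.
Qed.

Lemma eventually_dvd_exp d f m : eventually_dvd d f -> eventually_dvd d (f ^+ m).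
Proof.
move=> fZ; elim: m => [|m IH]; first exact: eventually_dvd1.
by rewrite exprS; apply: eventually_dvdM.
Qed.

Local Notation t := (fpsX int).

Definition iota2 : fps int := fun n => (~~ odd n)%:R.

(** This relation and the recurrences of [height_series] are put in the form of a vanishing
    expression: below, a quantity is written by [ring] as a combination of such expressions, and
    [dvd3_tac] discharges each summand. *)
Lemma iota2E : iota2 * (1 - t ^+ 2) - 1 = 0.
Proof.
apply/eqP; rewrite subr_eq0 mulrC mulrBl mul1r; apply/eqP/funext => n.
rewrite fpsDE fpsNE fpsXn_mulE fps1E /iota2.
case: n => [|[|n]] //; rewrite !ltnS ltn0 /= subSS subSS subn0 negbK.
by rewrite subrr.
Qed.

Local Notation w := (3%:R * iota2).

(* Exact polynomials are the series [c] with [eventually_dvd 0 c], since 0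
   divides only 0; so [wpoly] is the ring Z[t][w]. *)
Inductive wpoly : fps int -> Prop :=
| wpoly_const c of eventually_dvd 0 c : wpoly c
| wpoly_cons c x of eventually_dvd 0 c & wpoly x : wpoly (c + w * x).

Lemma wpolyw x : wpoly x -> wpoly (w * x).
Proof.
by move=> Ax; rewrite -[w * x]add0r; apply: wpoly_cons Ax; apply: eventually_dvd0.
Qed.

Lemma wpolyD x y : wpoly x -> wpoly y -> wpoly (x + y).
Proof.
move=> Ax; elim: Ax y => [c cP|c {}x cP Ax IH] y Ay.
  case: Ay => [d dP|d y' dP Ay]; first by apply: wpoly_const; apply: eventually_dvdD.
  by rewrite addrA; apply: wpoly_cons Ay; apply: eventually_dvdD.
case: Ay => [d dP|d y' dP Ay].
  by rewrite addrAC; apply: wpoly_cons Ax; apply: eventually_dvdD.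
rewrite addrACA -mulrDr; apply: wpoly_cons (IH _ Ay).
exact: eventually_dvdD.
Qed.

Lemma wpolyM x y : wpoly x -> wpoly y -> wpoly (x * y).
Proof.
have scal c z : eventually_dvd 0 c -> wpoly z -> wpoly (c * z).
  move=> cP; elim=> [d dP|d {}z dP Az IH].
    by apply: wpoly_const; apply: eventually_dvdM.
  rewrite mulrDr mulrCA; apply: wpoly_cons IH; exact: eventually_dvdM.
move=> Ax Ay; elim: Ax => [c cP|c {}x cP Ax IH]; first exact: scal.
by rewrite mulrDl -mulrA; apply: wpolyD; [exact: scal | exact: wpolyw].
Qed.

Lemma wpoly1 : wpoly 1.
Proof. exact: wpoly_const (eventually_dvd1 0). Qed.

Lemma wpolyX : wpoly t.
Proof. exact: wpoly_const (eventually_dvdX 0). Qed.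

Lemma wpolyN x : wpoly x -> wpoly (- x).
Proof.
rewrite -mulN1r; apply: wpolyM; apply: wpoly_const.
exact: eventually_dvdN (eventually_dvd1 0).
Qed.

Lemma wpoly_natr m : wpoly m%:R.
Proof. exact: wpoly_const (eventually_dvd_natr 0 m). Qed.

Lemma wpoly_exp x m : wpoly x -> wpoly (x ^+ m).
Proof.
move=> Ax; elim: m => [|m IH]; first exact: wpoly1.
by rewrite exprS; apply: wpolyM.
Qed.

Lemma wpoly_sum m (F : nat -> fps int) :
  (forall i, wpoly (F i)) -> wpoly (\sum_(i < m) F i).
Proof.
move=> AF; elim: m => [|m IH]; first by rewrite big_ord0; exact: wpoly_natr 0.
by rewrite big_ord_recr; apply: wpolyD.
Qed.

Lemma wpoly_w : wpoly w.
Proof. by rewrite -[w]mulr1; apply/wpolyw/wpoly1. Qed.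

(** The first pattern catches [w] as a whole, because [iota2] alone does not lie in [wpoly]. *)
Ltac wpoly_tac :=
  first [ assumption | lazymatch goal with
  | |- wpoly (_ * iota2) => exact: wpoly_w
  | |- wpoly (_ + _) => apply: wpolyD; wpoly_tac
  | |- wpoly (- _) => apply: wpolyN; wpoly_tac
  | |- wpoly (_ * _) => apply: wpolyM; wpoly_tac
  | |- wpoly (_ ^+ _) => apply: wpoly_exp; wpoly_tac
  | |- wpoly _ => first [exact: wpolyX | exact: wpoly1 | exact: wpoly_natr]
  end ].

(** Unlike [eventually_dvd], this constrains every coefficient, and so is preserved under
    multiplication by an arbitrary series. *)
Definition dvd3 (s : nat) (f : fps int) : Prop := exists e, f = 3%:R ^+ s * e.

Lemma dvd3_eq0 s f : f = 0 -> dvd3 s f.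
Proof. by move=> ->; exists 0; rewrite mulr0. Qed.

Lemma dvd3D s f g : dvd3 s f -> dvd3 s g -> dvd3 s (f + g).
Proof. by move=> [e ->] [e' ->]; exists (e + e'); rewrite mulrDr. Qed.

Lemma dvd3Ml s c f : dvd3 s f -> dvd3 s (c * f).
Proof. by move=> [e ->]; exists (c * e); rewrite mulrCA. Qed.

Lemma dvd3w s f : dvd3 s f -> dvd3 s.+1 (w * f).
Proof. by move=> [e ->]; exists (iota2 * e); rewrite exprS; ring. Qed.

Ltac dvd3_tac :=
  first [ assumption | lazymatch goal with
  | |- dvd3 _ (_ + _) => apply: dvd3D; dvd3_tac
  | |- dvd3 _ (_ * _) => apply: dvd3Ml; dvd3_tac
  end | by apply: dvd3_eq0 ].

(* Modulo [3 ^ s], [w] is nilpotent. *)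
Lemma wpoly_unit s a : wpoly a ->
  exists2 u, wpoly u & dvd3 s (u * (1 - w * a) - 1).
Proof.
move=> Aa; exists (\sum_(i < s) (w * a) ^+ i).
  by apply: wpoly_sum => i; wpoly_tac.
exists (- (iota2 * a) ^+ s); rewrite mulrN -exprMn mulrA.
have e x : x * (1 - w * a) - 1 = - ((w * a - 1) * x) - 1 by ring.
by rewrite e -subrX1 opprB addrAC subrr sub0r.
Qed.

(* A walk from height [h] to 0 has [h] more down-steps than up-steps; the
   index counts the up-steps. *)
Definition height_series (h : nat) : fps int :=
  fun n => word_sum morse_b (n.*2 + h) h%:Z.

Local Notation a := height_series.

Lemma height_series0 : a 0 - 1 - t * a 1 = 0.
Proof.
apply/eqP; rewrite -addrA -opprD subr_eq0; apply/eqP/funext => -[|n].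
  by rewrite fpsDE fpsX_mul0 addr0 /a word_sum0.
rewrite fpsDE fps1E add0r fpsX_mulS /a addn0 doubleS word_sumS //.
by rewrite [X in _ + X]word_sum_lt0 // addr0 addn1 /morse_b mulr0 add0r expr1n mul1r.
Qed.

Lemma height_seriesS h :
  a h.+1 - a h - (2%:R * h%:R + 3%:R) ^+ 2 * t * a h.+2 = 0.
Proof.
apply/eqP; rewrite -addrA -opprD subr_eq0; apply/eqP/funext => n.
have -> : (2%:R * h%:R + 3%:R) ^+ 2 = ((2 * h + 3) ^ 2)%:R :> fps int.
  by rewrite natrX natrD natrM.
rewrite -mulrA fpsDE fps_natME /a addnS word_sumS //.
have -> : h.+1%:Z - 1 = h by lia.
rewrite addrC; congr (_ + _).
have -> : morse_b h.+1%:Z = ((2 * h + 3) ^ 2)%:R.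
  by rewrite /morse_b natrX; congr (_ ^+ 2); lia.
(* At index 0 the up-step term vanishes: [h] steps cannot descend from height [h + 2] to 0. *)
congr (_ * _); case: n => [|n]; first by rewrite fpsX_mul0 word_sum_gt //; lia.
by rewrite fpsX_mulS /a; congr word_sum; lia.
Qed.

Lemma L_height_series n : L n = a 0 n.
Proof. by rewrite /L dyck_sumE /a addn0. Qed.

(** * Solving the recurrence *)

(** Here [Ai] stands for the series at height [3 J + i], and the relation between the top two
    heights is carried down one block. Eliminating [A4] and then [A3] gives [N A3 = A2] and
    [(N - b1 t) A2 = N A1] modulo [3 ^+ s]. The last elimination uses
    [b (3 J + 1) = 9 (2 J + 1) ^ 2]. *)
Lemma tail_step s (J x A0 A1 A2 A3 A4 : fps int) :
    wpoly J -> wpoly x ->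
    A1 - A0 - (6%:R * J + 3%:R) ^+ 2 * t * A2 = 0 ->
    A2 - A1 - (6%:R * J + 5%:R) ^+ 2 * t * A3 = 0 ->
    A3 - A2 - (6%:R * J + 7%:R) ^+ 2 * t * A4 = 0 ->
    dvd3 s (A4 - (1 + 3%:R * (2%:R * J + 3%:R) ^+ 2 * w * x) * A3) ->
  exists2 x', wpoly x' &
    dvd3 s.+1 (A1 - (1 + 3%:R * (2%:R * J + 1) ^+ 2 * w * x') * A0).
Proof.
move=> AJ Ax H1 H2 H3 H4; have Hq := iota2E.
set b1 := (_ ^+ 2 : fps int) in H2; set b2 := (_ ^+ 2 : fps int) in H3.
set B' := (_ ^+ 2 : fps int) in H4; set B := (_ ^+ 2 : fps int).
have {}H1 : A1 - A0 - 9%:R * B * t * A2 = 0 by rewrite -H1 /B; ring.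
(* Since [b1 + b2] is -1 modulo 3, the denominator [N - b1 t] is [1 + t] modulo 3. *)
have b12 : b1 = 2%:R + 72%:R * (J + 1) ^+ 2 - b2 by rewrite /b1 /b2; ring.
have AB : wpoly B by rewrite /B; wpoly_tac.
have AB' : wpoly B' by rewrite /B'; wpoly_tac.
have Ab2 : wpoly b2 by rewrite /b2; wpoly_tac.
pose N := 1 - b2 * t * (1 + 3%:R * B' * w * x).
(* Chosen so that [N - b1 t = 1 + t - 3 z]; as [3 = w (1 - t ^+ 2)], this equals
   [(1 + t) (1 - w (1 - t) z)], whose second factor is invertible. *)
pose z := t * (1 + 24%:R * (J + 1) ^+ 2 + b2 * B' * w * x).
have AN : wpoly N by rewrite /N; wpoly_tac.
have [u Au U1] : exists2 u, wpoly u & dvd3 s (u * (1 - w * ((1 - t) * z)) - 1).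
  by apply: wpoly_unit; rewrite /z; wpoly_tac.
have K1 : dvd3 s (N * A3 - A2).
  rewrite (_ : _ - _ = (A3 - A2 - b2 * t * A4) +
    b2 * t * (A4 - (1 + 3%:R * B' * w * x) * A3)); first by dvd3_tac.
  by rewrite /N; ring.
have K2 : dvd3 s ((1 + t) * (1 - w * ((1 - t) * z)) * A2 - N * A1).
  rewrite (_ : _ - _ = N * (A2 - A1 - b1 * t * A3) + b1 * t * (N * A3 - A2) +
    - 3%:R * z * A2 * (iota2 * (1 - t ^+ 2) - 1)); first by dvd3_tac.
  by rewrite /N /z b12; ring.
have K3 : dvd3 s ((1 + t) * A2 - u * N * A1).
  rewrite (_ : _ - _ = u * ((1 + t) * (1 - w * ((1 - t) * z)) * A2 - N * A1) +
    - (1 + t) * A2 * (u * (1 - w * ((1 - t) * z)) - 1)); first by dvd3_tac.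
  by ring.
(* Multiplication by [w (1 - t)], which is [3 / (1 + t)], removes the factor [1 + t] and gains a
   power of 3. Only [3 A2] is needed, as [A2] enters [H1] with coefficient [9 B t]. *)
have K4 : dvd3 s.+1 (3%:R * A2 - w * (1 - t) * u * N * A1).
  rewrite (_ : _ - _ = w * ((1 - t) * ((1 + t) * A2 - u * N * A1)) +
    - 3%:R * A2 * (iota2 * (1 - t ^+ 2) - 1)); last by ring.
  by apply: dvd3D; [apply: dvd3w|]; dvd3_tac.
pose y := t * (1 - t) * u * N.
have Ay : wpoly y by rewrite /y; wpoly_tac.
have K5 : dvd3 s.+1 ((1 - w * (3%:R * B * y)) * A1 - A0).
  rewrite (_ : _ - _ = (A1 - A0 - 9%:R * B * t * A2) +
    3%:R * B * t * (3%:R * A2 - w * (1 - t) * u * N * A1)); first by dvd3_tac.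
  by rewrite /y; ring.
have [u' Au' U2] : exists2 u', wpoly u' &
    dvd3 s.+1 (u' * (1 - w * (3%:R * B * y)) - 1).
  by apply: wpoly_unit; wpoly_tac.
(* This is [1 / (1 - v) = 1 + v / (1 - v)] with [v = 3 B w y]. *)
exists (y * u'); first by wpoly_tac.
rewrite (_ : _ - _ = u' * ((1 - w * (3%:R * B * y)) * A1 - A0) +
  (A0 - A1) * (u' * (1 - w * (3%:R * B * y)) - 1)); first by dvd3_tac.
by ring.
Qed.

(* Multiplying by [b (3 * j + 1)], which is divisible by 9, gains one power of
   3 over the error of the relation three levels higher. *)
Lemma height_series_tail s j : exists2 x, wpoly x &
  dvd3 s (a (3 * j).+1
    - (1 + 3%:R * (2%:R * j%:R + 1) ^+ 2 * w * x) * a (3 * j)%N).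
Proof.
elim: s j => [|s IH] j.
  by exists 1; [exact: wpoly1 | eexists; rewrite mul1r].
have [x Ax] := IH j.+1; rewrite (_ : 3 * j.+1 = (3 * j).+3)%N; last by lia.
move=> H4; apply: (@tail_step s j%:R x _ _ (a (3 * j).+2) (a (3 * j).+3)
  (a (3 * j).+4) _ Ax); first exact: wpoly_natr.
- rewrite -[RHS](height_seriesS (3 * j)) natrM.
  by congr (_ - _ * _ * _); congr (_ ^+ 2); ring.
- rewrite -[RHS](height_seriesS (3 * j).+1) -[(3 * j).+1%:R]natr1 natrM.
  by congr (_ - _ * _ * _); congr (_ ^+ 2); ring.
- rewrite -[RHS](height_seriesS (3 * j).+2) -[(3 * j).+2%:R]natr1
    -[(3 * j).+1%:R]natr1 natrM.
  by congr (_ - _ * _ * _); congr (_ ^+ 2); ring.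
- rewrite (_ : 2%:R * j%:R + 3%:R = 2%:R * j.+1%:R + 1) //.
  by rewrite -[j.+1%:R]natr1; ring.
Qed.

(** The lowest block is solved as in [tail_step], but closed by [a 0 = 1 + t * a 1], which makes the
    denominator [1 - t ^+ 2] modulo 3. The extra factor 3 before [w ^+ 2] later supplies the last
    power of 3. *)
Lemma height_series0_form s : exists p x, [/\ eventually_dvd 0 p, wpoly x &
  dvd3 s (a 0 - (iota2 * p + 3%:R * w ^+ 2 * x))].
Proof.
have [x Ax H4] := height_series_tail s 1.
have := height_seriesS 2; have := height_seriesS 1; have := height_seriesS 0.
have := height_series0; have Hq := iota2E; move: H4; rewrite muln1.
set A0 := a 0; set A1 := a 1; set A2 := a 2; set A3 := a 3; set A4 := a 4.
move=> H4 H0 H1 H2 H3.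
have {}H1 : A1 - A0 - 9%:R * t * A2 = 0 by rewrite -H1; ring.
have {}H2 : A2 - A1 - 25%:R * t * A3 = 0 by rewrite -H2; ring.
have {}H3 : A3 - A2 - 49%:R * t * A4 = 0 by rewrite -H3; ring.
have b4 : 3%:R * (2%:R * 1%:R + 1) ^+ 2 = 27%:R :> fps int by ring.
rewrite {}b4 in H4.
pose N := 1 - 49%:R * t * (1 + 27%:R * w * x); pose D := N - 25%:R * t.
(* [z] is read off from [(1 - t) D - 9 t N = 1 - t ^+ 2 - 3 z], and [z'] collects its multiples of
   9. *)
pose z' := - (16%:R * t ^+ 2) + 49%:R * w * (1 - t) * t * x
  - 441%:R * w * t ^+ 2 * x.
pose z := 28%:R * t * (1 - t) + 9%:R * z'.
have Az' : wpoly z' by rewrite /z'; wpoly_tac.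
have Az : wpoly z by rewrite /z; wpoly_tac.
have [u Au U] := @wpoly_unit s _ Az.
have K1 : dvd3 s (N * A3 - A2).
  rewrite (_ : _ - _ = (A3 - A2 - 49%:R * t * A4) +
    49%:R * t * (A4 - (1 + 27%:R * w * x) * A3)); first by dvd3_tac.
  by rewrite /N; ring.
have K2 : dvd3 s (D * A2 - N * A1).
  rewrite (_ : _ - _ = N * (A2 - A1 - 25%:R * t * A3) +
    25%:R * t * (N * A3 - A2)); first by dvd3_tac.
  by rewrite /D; ring.
have K3 : dvd3 s ((D - 9%:R * t * N) * A1 - D * A0).
  rewrite (_ : _ - _ = D * (A1 - A0 - 9%:R * t * A2) +
    9%:R * t * (D * A2 - N * A1)); first by dvd3_tac.
  by ring.
have K4 : dvd3 s ((1 - t ^+ 2) * (1 - w * z) * A0 - (D - 9%:R * t * N)).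
  rewrite (_ : _ - _ = (D - 9%:R * t * N) * (A0 - 1 - t * A1) +
    t * ((D - 9%:R * t * N) * A1 - D * A0) +
    - 3%:R * z * A0 * (iota2 * (1 - t ^+ 2) - 1)); first by dvd3_tac.
  by rewrite /D /N /z /z'; ring.
have K5 : dvd3 s ((1 - t ^+ 2) * A0 - u * (D - 9%:R * t * N)).
  rewrite (_ : _ - _ =
    u * ((1 - t ^+ 2) * (1 - w * z) * A0 - (D - 9%:R * t * N)) +
    - (1 - t ^+ 2) * A0 * (u * (1 - w * z) - 1)); first by dvd3_tac.
  by ring.
(* One has [D - 9 t N = p - 84 t + 9 w x'] and [u = 1 + w z u] modulo [3 ^+ s]. In [p w z u] the
   product of [1 + t] with the part [28 t (1 - t)] of [z] gives [84 t u], which cancels [- 84 t u];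
   the rest is [9 w X]. *)
pose p := 1 + t + 441%:R * t ^+ 2.
pose x' := 1323%:R * t ^+ 2 * x - 147%:R * t * x.
pose X := z' * (1 + t) * u + 49%:R * t ^+ 2 * z * u + x' * u.
have K6 : dvd3 s ((1 - t ^+ 2) * A0 - p - 9%:R * w * X).
  rewrite (_ : _ - _ = ((1 - t ^+ 2) * A0 - u * (D - 9%:R * t * N)) +
    (1 + t + 441%:R * t ^+ 2) * (u * (1 - w * z) - 1) +
    84%:R * t * u * (iota2 * (1 - t ^+ 2) - 1)); first by dvd3_tac.
  by rewrite /X /x' /p /D /N /z; ring.
exists p, X; split.
- rewrite /p; do ![apply: eventually_dvdD].
  + exact: eventually_dvd1.
  + exact: eventually_dvdX.
  + apply: eventually_dvdM; first exact: eventually_dvd_natr.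
    by apply: eventually_dvd_exp; apply: eventually_dvdX.
- by rewrite /X /x'; wpoly_tac.
- rewrite (_ : _ - _ = iota2 * ((1 - t ^+ 2) * A0 - p - 9%:R * w * X) +
    - A0 * (iota2 * (1 - t ^+ 2) - 1)); first by dvd3_tac.
  by ring.
Qed.

(** * Periodicity *)

Definition period_diff (k : nat) : fps int := 1 - t ^+ (2 * 3 ^ k)%N.

Local Notation d := period_diff.

Lemma period_diffS k : d k.+1 = d k * (3%:R - 3%:R * d k + d k ^+ 2).
Proof.
rewrite /d expnSr mulnA exprM; move: (t ^+ _) => y; ring.
Qed.

Lemma eventually_dvd_period_diff k : eventually_dvd 0 (d k).
Proof.
apply: eventually_dvdD; first exact: eventually_dvd1.
by apply: eventually_dvdN; apply: eventually_dvd_exp; apply: eventually_dvdX.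
Qed.

Lemma eventually_dvd_period_diff_iota2 k : eventually_dvd 0 (d k * iota2).
Proof.
rewrite /d exprM -opprB subrX1 -mulNr opprB mulrAC.
rewrite (_ : (1 - t ^+ 2) * iota2 = 1) ?mul1r; last first.
  by apply/eqP; rewrite -subr_eq0 mulrC iota2E.
elim/big_ind: _ => [|x y|i _]; first exact: eventually_dvd0.
- exact: eventually_dvdD.
- by do 2![apply: eventually_dvd_exp]; apply: eventually_dvdX.
Qed.

(** Only [j = 1] is used later, but the induction on [k] needs every [j], because expanding
    [d k.+1 ^+ j] produces higher powers of [d k]. *)
Lemma eventually_dvd_period_diff_exp k i j : (0 < j)%N ->
  eventually_dvd (3%:R ^+ (k.+1 * j).+1) (d k ^+ j * w ^+ i).
Proof.
elim: k i j => [|k IH] i j j_gt0.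
  have q1 m : d 0 ^+ m * iota2 ^+ m = 1.
    rewrite -exprMn (_ : d 0 * iota2 = 1) ?expr1n // /d muln1.
    by apply/eqP; rewrite -subr_eq0 mulrC iota2E.
  (* As [d 0] is inverse to [iota2], all denominators cancel when [i <= j]; otherwise [3 ^+ i]
     already contains [3 ^+ j.+1]. *)
  rewrite mul1n exprMn; have [le_ij|lt_ji] := leqP i j.
    apply: (@eventually_dvd_weaken _ 0); first exact: dvdz0.
    rewrite -(subnK le_ij) exprD -mulrA [d 0 ^+ i * _]mulrCA q1 mulr1.
    apply: eventually_dvdM.
      by apply: eventually_dvd_exp; apply: eventually_dvd_period_diff.
    by apply: eventually_dvd_exp; apply: eventually_dvd_natr.
  rewrite -(subnKC lt_ji) [3%:R ^+ (_ + _)]exprD -!natrX -!mulrA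
    [d 0 ^+ j * (_ * _)]mulrCA.
  exact: eventually_dvd_nat.
(* Each factor [3 - 3 d + d ^ 2] gains at least one power of 3: explicitly in its first two terms,
   and through the larger exponent of [d k] in the third. *)
have step m j' : (0 < j')%N -> eventually_dvd (3%:R ^+ (k.+1 * j' + m).+1)
    (d k ^+ j' * (3%:R - 3%:R * d k + d k ^+ 2) ^+ m * w ^+ i).
  elim: m j' => [|m IHm] j' j'_gt0; first by rewrite addn0 mulr1; apply: IH.
  rewrite (_ : _ * _ =
    3%:R * (d k ^+ j' * (3%:R - 3%:R * d k + d k ^+ 2) ^+ m * w ^+ i) +
    - (3%:R * (d k ^+ j'.+1 * (3%:R - 3%:R * d k + d k ^+ 2) ^+ m * w ^+ i)) +
    d k ^+ j'.+2 * (3%:R - 3%:R * d k + d k ^+ 2) ^+ m * w ^+ i); last first.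
    by rewrite !exprS; ring.
  apply: eventually_dvdD; [apply: eventually_dvdD|].
  - by rewrite addnS exprS; apply: eventually_dvd_natM; apply: IHm.
  - apply: eventually_dvdN; rewrite addnS exprS.
    apply: eventually_dvd_natM; apply: eventually_dvd_weaken (IHm j'.+1 _) => //.
    by apply: dvdz_exp2l; rewrite mulnS; lia.
  - apply: eventually_dvd_weaken (IHm j'.+2 _) => //.
    by apply: dvdz_exp2l; rewrite !mulnS; lia.
rewrite period_diffS exprMn; have := step j j j_gt0.
by rewrite -mulSnr.
Qed.

(** The power [w ^+ i] absorbs the factors [w] peeled off in the induction on [x]. *)
Lemma eventually_dvd_period_diff_wpoly k i x : wpoly x ->
  eventually_dvd (3%:R ^+ k.+2) (d k * (w ^+ i * x)).
Proof.
move=> Ax; have scal m c : eventually_dvd 0 c ->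
    eventually_dvd (3%:R ^+ k.+2) (d k * (w ^+ m * c)).
  move=> c0; rewrite mulrA; apply: eventually_dvdM.
    by have := @eventually_dvd_period_diff_exp k m 1 isT; rewrite muln1 expr1.
  by apply: eventually_dvd_weaken c0; apply: dvdz0.
elim: Ax i => [c c0|c {}x c0 _ IH] i; first exact: scal.
rewrite !mulrDr [w ^+ i * (w * x)]mulrA -exprSr.
by apply: eventually_dvdD; [exact: scal | exact: IH].
Qed.

Theorem theorem4p8 (r : nat) (hr : (3 <= r)%N) :
  exists N : nat, forall n : nat, (N <= n)%N ->
    (L (n + 2 * 3 ^ (r - 3))%N = L n %[mod (3 ^+ r : int)])%Z.
Proof.
have [k def_r] : exists k, r = k.+3 by exists (r - 3)%N; lia.
rewrite {hr}def_r (_ : k.+3 - 3 = k)%N; last by lia.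
have [p [x [pP Ax [e def_a]]]] := height_series0_form k.+3.
have [N dvdN] : eventually_dvd (3%:R ^+ k.+3) (d k * a 0).
  rewrite (_ : d k * a 0 = d k * iota2 * p + d k * (3%:R * w ^+ 2 * x) +
    3%:R ^+ k.+3 * (d k * e)); last first.
    by move/(canRL (subrK _)): def_a => ->; ring.
  apply: eventually_dvdD; first apply: eventually_dvdD.
  - apply: (@eventually_dvd_weaken _ 0); first exact: dvdz0.
    by apply: eventually_dvdM; first exact: eventually_dvd_period_diff_iota2.
  - rewrite -[_ * w ^+ 2 * x]mulrA mulrCA exprS; apply: eventually_dvd_natM.
    exact: eventually_dvd_period_diff_wpoly.
  - by rewrite -!natrX; apply: eventually_dvd_nat.
exists N => n leNn; apply/eqP; rewrite eqz_mod_dvd !L_height_series.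
(* The coefficient of [d k * a 0] at this shifted index is the difference of the two values of
   [L]. *)
have := dvdN (n + 2 * 3 ^ k)%N (leq_trans leNn (leq_addr _ _)).
rewrite /d mulrBl mul1r fpsDE fpsNE fpsXn_mulE ltnNge leq_addl addnK.
by [].
Qed.
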